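(* Every finite set $P\subset\mathbb{R}^2$ with $|P|\ge 880$ contains four (distinct) collinear points or six (distinct) pairwise visible points. Equivalently, $N(4,6)\le 880$.
   Context: Let $P$ be a finite set of points in the plane $\mathbb{R}^2$. Two distinct points of $P$ are visible (with respect to $P$) if the open segment joining them contains no point of $P$. For integers $s,t\ge 3$, $N(s,t)$ denotes the least integer, if it exists, such that every finite planar set of at least $N(s,t)$ points contains $s$ collinear points or $t$ pairwise visible points. *)

(* Defs.v *)
From HB Require Import structures.
From mathcomp Require Import all_boot all_order all_algebra.
From mathcomp Require Import finmap reals.
Set Implicit Arguments.
Unset Strict Implicit.
Unset Printing Implicit Defensive.
Import Order.TTheory GRing.Theory Num.Theory.
Local Open Scope fset_scope.
Local Open Scope ring_scope.

Definition in_open_segment (R : realType) (x y z : 'rV[R]_2) : Prop :=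
  exists2 t : R, 0 < t < 1 & z = (1 - t) *: x + t *: y.

Definition visible (R : realType) (P : {fset 'rV[R]_2}) (x y : 'rV[R]_2) : Prop :=
  x != y /\ forall z, z \in P -> ~ in_open_segment x y z.

(* The points of S lie on the line through p with direction v. *)
Definition collinear (R : realType) (S : {fset 'rV[R]_2}) : Prop :=
  exists p v : 'rV[R]_2,
    v != 0 /\ forall x, x \in S -> exists a : R, x = p + a *: v.

Definition contains_collinear (R : realType) (s : nat) (P : {fset 'rV[R]_2}) : Prop :=
  exists S : {fset 'rV[R]_2}, [/\ S `<=` P, #|` S| = s & collinear S].

(* Visibility is blocked by all points of P, not only by those of the chosen
   subset T. *)
Definition contains_visible (R : realType) (t : nat) (P : {fset 'rV[R]_2}) : Prop :=
  exists T : {fset 'rV[R]_2},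
    [/\ T `<=` P, #|` T| = t &
        forall x y, x \in T -> y \in T -> x != y -> visible P x y].

Definition forces (R : realType) (s t n : nat) : Prop :=
  forall P : {fset 'rV[R]_2}, (n <= #|` P|)%N ->
    contains_collinear s P \/ contains_visible t P.

(* N(s, t) need not exist, so it is given by its graph: is_N R s t n states that
   N(s, t) exists and equals n. For s, t >= 3 the least such integer is
   automatically a natural number, as the empty set rules out n <= 0. *)
Definition is_N (R : realType) (s t n : nat) : Prop :=
  forces R s t n /\ forall m, forces R s t m -> (n <= m)%N.

(* Main.v *)
(** Suppose that at least 876 = 6 * 146 points are given, no four collinear and
no six pairwise visible, and call a pair blocked when it is not visible.  Every
6-subset contains a blocked pair, so by Turan's argument every set I of s points
contains at least s (s - 5) / 10 of them.  If I is an island, i.e. a convex piece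
of the configuration, a blocker of a pair of I lies in I.  As no four points are
collinear, each pair of points belongs to at most one collinear triple.

Three lines cut 876 of the points into cells: l halves them, d cuts off 146
points of each half, and e bisects what remains of each half.  Since d and e
cross at most once, on one side of l the part cut off by d lies entirely on one
side of e, so there are at most seven cells.  For a family of islands bounded by these
lines such that every collinear triple a, b, c has at least as many pairs inside
one cell as there are islands of the family containing it, double counting gives
    sum over islands of s (s - 5)  <=  5 * sum over cells of x (x - 1).
All cell sizes are known up to one parameter w, and two families of islands
contradict this inequality, one for w <= 109 and the other for w >= 110. *)

Require Import Defs.
From HB Require Import structures.
From mathcomp Require Import all_boot all_order all_algebra.
From mathcomp Require Import finmap reals boolp.
From mathcomp Require Import zify ring lra.
Import Order.TTheory GRing.Theory Num.Theory.

(** * A Turan bound for blocked pairs *)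

Section Turan.
Variables (T : finType) (blk : rel T).
Hypothesis blkC : symmetric blk.
Hypothesis no_clique6 : forall Q : {set T}, #|Q| = 6 ->
  exists u v, [/\ u \in Q, v \in Q, u != v & blk u v].

(** Pairs are ordered, so a blocked pair of distinct points counts twice; hence the factor 5, not
    10, in [arcs_lb]. *)
Definition arcs (I : {set T}) := \sum_(u in I) \sum_(v in I) (blk u v : nat).

(* Pad a maximal visible subset of [I] to five points. *)
Lemma dominating5 (I : {set T}) : 5 <= #|I| ->
  exists2 K : {set T}, K \subset I /\ #|K| = 5 &
    forall v, v \in I :\: K -> exists2 u, u \in K & blk u v.
Proof.
move=> I5; pose clq (Q : {set T}) :=
  (Q \subset I) && [forall u in Q, forall v in Q, (u != v) ==> ~~ blk u v].
have clq0 : clq set0.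
  by rewrite /clq sub0set; apply/forall_inP => u; rewrite inE.
have [M /maxsetP[/andP[MI /forall_inP Mclq] Mmax] _] := maxset_exists clq0.
have M5 : #|M| <= 5.
  rewrite leqNgt; apply/negP => /card_geqP[s [s_uniq s_size sM]].
  have cQ : #|[set x in s]| = 6 by rewrite cardsE (card_uniqP s_uniq).
  have [u [v []]] := no_clique6 _ cQ.
  rewrite !inE => /sM uM /sM vM uv; apply/negP.
  by move/forall_inP/(_ _ vM)/implyP/(_ uv): (Mclq _ uM).
have pad n : forall M' : {set T}, n + #|M'| = 5 -> M' \subset I ->
    exists K : {set T}, [/\ M' \subset K, K \subset I & #|K| = 5].
  elim: n => [|n IH] M' nM MI'; first by exists M'; split=> //; lia.
  have : 0 < #|I :\: M'| by have := cardsDS MI'; lia.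
  case/card_gt0P => z; rewrite inE => /andP[zM zI].
  have cz : #|z |: M'| = #|M'|.+1 by rewrite cardsU1 zM.
  have [||K [sK KI K5]] := IH (z |: M'); rewrite ?cz; try lia.
    by apply/subsetP => y; rewrite !inE => /orP[/eqP->//|]; apply: (subsetP MI').
  by exists K; split=> //; apply: subset_trans sK; apply: subsetUr.
have [K [MK KI K5]] := pad (5 - #|M|) M (subnK M5) MI.
exists K => // v; rewrite inE => /andP[vK vI].
have vM : v \notin M by apply: contra vK; apply: (subsetP MK).
case: (pickP [pred u in M | blk u v]) => [u /andP[uM uv]|nov].
  by exists u => //; apply: (subsetP MK).
case/negP: vM; suff <- : v |: M = M by apply: setU11.
apply: Mmax; last exact: subsetUr.
rewrite /clq subUset sub1set vI MI /=; apply/forall_inP => x xM.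
apply/forall_inP => y yM; apply/implyP => xy.
have novE u : u \in M -> blk u v = false by move=> uM; have:= nov u; rewrite /= uM.
move: xM yM; rewrite !inE => /predU1P[xv|xM] /predU1P[yv|yM].
- by rewrite xv yv eqxx in xy.
- by rewrite xv blkC novE.
- by rewrite yv novE.
- by move/forall_inP/(_ _ yM)/implyP/(_ xy): (Mclq _ xM).
Qed.

(** Remove the five points given by [dominating5]. Each of the other s - 5 points is blocked from
    one of them, which yields 2 (s - 5) ordered pairs, and induction treats the rest: 10 (s - 5) +
    (s - 5) (s - 10) = s (s - 5). *)
Lemma arcs_lb (I : {set T}) : #|I| * (#|I| - 5) <= 5 * arcs I.
Proof.
have [n] := ubnP #|I|; elim: n I => // n IH I In.
(* By definition [m <= n] is [m - n == 0], so the truncated factor vanishes. *)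
have [I5|I5] := leqP #|I| 5; first by rewrite (eqP I5) muln0.
have [K [KI K5] Kdom] := dominating5 _ (ltnW I5).
have cI : #|I :\: K| = #|I| - 5 by rewrite cardsDS ?K5.
have splitI (F : T -> nat) : \sum_(u in I) F u = \sum_(u in K) F u + \sum_(u in I :\: K) F u.
  rewrite (big_setID K) /=; congr addn; apply: eq_bigl => u.
  by rewrite (setIidPr KI).
have dom : #|I :\: K| <= \sum_(u in I :\: K) \sum_(v in K) (blk u v : nat).
  rewrite -sum1_card; apply: leq_sum => v /Kdom[u uK uv].
  by rewrite (bigD1 u) //= blkC uv.
have dom' : #|I :\: K| <= \sum_(u in K) \sum_(v in I :\: K) (blk u v : nat).
  rewrite exchange_big /=; apply: leq_trans dom _; apply: leq_sum => v _.
  by apply: leq_sum => u _; rewrite blkC.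
have split2 : #|I :\: K| + #|I :\: K| + arcs (I :\: K) <= arcs I.
  rewrite /arcs splitI.
  under [X in _ <= X + _]eq_bigr do rewrite splitI.
  under [X in _ <= _ + X]eq_bigr do rewrite splitI.
  rewrite !big_split /= addnA leq_add2r; lia.
have := IH (I :\: K); rewrite cI => /(_ ltac:(lia)).
move: split2; rewrite cI; move: (arcs _) (arcs _) => p q; nia.
Qed.

End Turan.

(** * Double counting of collinear triples *)

Section Counting.
Variables (T : finType) (btw : T -> T -> T -> bool).
Let blk u v := [exists w, btw u w v].
Hypothesis btwC : forall a b c, btw a b c = btw c b a.
Hypothesis btw_neq : forall a b c, btw a b c -> [/\ a != b, b != c & a != c].
Hypothesis line_le1 : forall u v, u != v ->
  \sum_w (btw u w v + btw u v w + btw w u v) <= 1.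
Hypothesis no_clique6 : forall Q : {set T}, #|Q| = 6 ->
  exists u v, [/\ u \in Q, v \in Q, u != v & blk u v].

Lemma blk_sym : symmetric blk.
Proof. by move=> u v; apply: eq_existsb => w. Qed.

(** Pick a blocker for every blocked pair of an island. Then [credit] pays for the islands holding
    both ends of a triple with pairs of that triple related by [S], and by [line_le1] no pair pays
    for two triples. *)
Lemma islands_le_same_cell (qs : seq {set T}) (S : rel T) :
  (forall a b c, btw a b c ->
     \sum_(I <- qs) ((a \in I) && (c \in I)) <= S a c + S a b + S b c) ->
  \sum_(I <- qs) #|I| * (#|I| - 5) <= 5 * \sum_u \sum_(v | u != v) (S u v : nat).
Proof.
move=> credit.
have arcsE I : arcs T blk I <= \sum_a \sum_c \sum_b btw a b c * ((a \in I) && (c \in I)).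
  rewrite /arcs [X in X <= _]big_mkcond /=; apply: leq_sum => a _.
  case: ifP => aI; last by [].
  rewrite [X in X <= _]big_mkcond /=; apply: leq_sum => c _.
  case: ifP => cI; last by [].
  have [/existsP[w abc]|//] := boolP (blk a c).
  by rewrite (bigD1 w) //= abc.
apply: (@leq_trans (\sum_(I <- qs) 5 * arcs T blk I)).
  by apply: leq_sum => I _; apply: arcs_lb => //; apply: blk_sym.
rewrite -big_distrr leq_mul2l /=.
apply: (leq_trans (leq_sum _ (fun I _ => arcsE I))).
rewrite exchange_big /=.
apply: (@leq_trans (\sum_a \sum_c \sum_b (btw a b c * S a c + btw a b c * S a b + btw a b c * S b c))).
  apply: leq_sum => a _; rewrite exchange_big /=; apply: leq_sum => c _.
  rewrite exchange_big /=; apply: leq_sum => b _.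
  case abc : (btw a b c); last by rewrite big1.
  by rewrite -!mulnDr -big_distrr /= !mul1n; apply: credit.
(* Regroup by the pair (u, v) tested by [S]: it consists of both ends of the triple, or of the
   middle point and one end. *)
have -> : \sum_a \sum_c \sum_b (btw a b c * S a c + btw a b c * S a b + btw a b c * S b c)
   = \sum_u \sum_v S u v * \sum_w (btw u w v + btw u v w + btw w u v).
  under eq_bigr => a _ do under eq_bigr => c _ do rewrite !big_split /=.
  under eq_bigr => a _ do rewrite !big_split /=.
  rewrite !big_split /=.
  under [RHS]eq_bigr => u _ do under eq_bigr => v _ do rewrite !big_split /= !mulnDr !big_distrr /=.
  under [RHS]eq_bigr => u _ do rewrite !big_split /=.
  rewrite !big_split /=; congr (_ + _ + _).
  - by apply: eq_bigr => a _; apply: eq_bigr => c _; apply: eq_bigr => b _; rewrite mulnC.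
  - apply: eq_bigr => a _; rewrite exchange_big; apply: eq_bigr => c _.
    by apply: eq_bigr => b _; rewrite mulnC.
  - rewrite exchange_big /=; under eq_bigr do rewrite exchange_big /=.
    rewrite exchange_big /=; apply: eq_bigr => a _; apply: eq_bigr => c _.
    by apply: eq_bigr => b _; rewrite mulnC.
apply: leq_sum => u _; rewrite [X in _ <= X]big_mkcond /=; apply: leq_sum => v _.
case: ifP => [uv|/negbFE/eqP <-].
  by rewrite -[X in _ <= X]muln1 leq_mul2l line_le1 ?orbT.
rewrite big1 ?muln0 // => w _.
suff [-> -> ->] : [/\ btw u w u = false, btw u u w = false & btw w u u = false] by [].
by split; apply/negP => /btw_neq[]; rewrite eqxx.
Qed.

End Counting.

(** * Sizes of cells and islands *)

Lemma sum_same_class (T K : finType) (W : {set T}) (k : T -> K) :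
  \sum_u \sum_(v | u != v) ([&& u \in W, v \in W & k u == k v] : nat) =
  \sum_c #|[set p in W | k p == c]| * #|[set p in W | k p == c]|.-1.
Proof.
transitivity (\sum_(u in W) #|[set p in W | k p == k u]|.-1).
  rewrite [RHS]big_mkcond /=; apply: eq_bigr => u _; case: ifP => uW; last by rewrite big1.
  rewrite (cardsD1 u) !inE uW eqxx /= -sum1_card big_mkcond [RHS]big_mkcond /=.
  by apply: eq_bigr => v _; rewrite !inE eq_sym [k u == _]eq_sym; case: (v == u); case: (v \in W); case: (k v == k u).
rewrite (partition_big k predT) //=; apply: eq_bigr => c _.
rewrite (eq_bigr (fun=> #|[set p in W | k p == c]|.-1)); last by move=> u /andP[_ /eqP ->].
rewrite sum_nat_const; congr (_ * _).
by apply: eq_card => u; rewrite !inE.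
Qed.

Lemma sum_bool3 (F : bool * bool * bool -> nat) : \sum_c F c =
  F (true, true, true) + F (true, true, false) + (F (true, false, true) + F (true, false, false)) +
  (F (false, true, true) + F (false, true, false) + (F (false, false, true) + F (false, false, false))).
Proof.
rewrite (eq_bigr (fun c => F (c.1, c.2))); last by case.
rewrite -(pair_bigA _ (fun xy z => F (xy, z))) /=.
rewrite (eq_bigr (fun c => \sum_z F (c.1, c.2, z))); last by case.
by rewrite -(pair_bigA _ (fun x y => \sum_z F (x, y, z))) !big_bool.
Qed.

Section Cells.
Variables (T : finType) (W : {set T}) (l d e : T -> bool).

Definition cell x y z := #|[set p in W | [&& l p == x, d p == y & e p == z]]|.
(** With islands given by Boolean functions of the three sides, the credit condition becomes a
    finite check on signs, and sizes follow from the eight cell sizes. *)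
Definition island (Q : bool -> bool -> bool -> bool) := [set p in W | Q (l p) (d p) (e p)].

Lemma card_island Q : #|island Q| =
  Q true true true * cell true true true + Q true true false * cell true true false +
  (Q true false true * cell true false true + Q true false false * cell true false false) +
  (Q false true true * cell false true true + Q false true false * cell false true false +
  (Q false false true * cell false false true + Q false false false * cell false false false)).
Proof.
have cE x y z : cell x y z = \sum_(p in W) [&& l p == x, d p == y & e p == z].
  by rewrite /cell -sum1_card big_mkcond [RHS]big_mkcond /=; apply: eq_bigr => p _; rewrite inE; case: (p \in W) => //=; case: ifP.
rewrite !cE !big_distrr -!big_split /= /island -sum1_card big_mkcond [RHS]big_mkcond /=.
apply: eq_bigr => p _; rewrite inE; case: (p \in W) => //=.
by case: (l p); case: (d p); case: (e p); rewrite /= ?muln0 ?muln1 ?addn0 ?add0n; case: (Q _ _ _).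
Qed.

End Cells.

(** * The numerical contradiction for three lines *)

Section ThreeLines.
Variables (T : finType) (btw : T -> T -> T -> bool).
Hypothesis btwC : forall a b c, btw a b c = btw c b a.
Hypothesis btw_neq : forall a b c, btw a b c -> [/\ a != b, b != c & a != c].
Hypothesis line_le1 : forall u v, u != v ->
  \sum_w (btw u w v + btw u v w + btw w u v) <= 1.
Hypothesis no_clique6 : forall Q : {set T}, #|Q| = 6 ->
  exists u v, [/\ u \in Q, v \in Q, u != v & [exists w, btw u w v]].

Variables (W : {set T}) (l d e : T -> bool).
Hypothesis W_conv : forall a b c, btw a b c -> a \in W -> c \in W -> b \in W.
Hypothesis l_conv : forall a b c, btw a b c -> l a = l c -> l b = l a.
Hypothesis d_conv : forall a b c, btw a b c -> d a = d c -> d b = d a.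
Hypothesis e_conv : forall a b c, btw a b c -> e a = e c -> e b = e a.

(* The third coordinate of a cell is [f l d e] instead of [e], so that cells can be merged. *)
Lemma cells_ineq (qs : seq (bool -> bool -> bool -> bool)) (f : bool -> bool -> bool -> bool) :
  (forall a b c, btw a b c -> a \in W -> b \in W -> c \in W ->
   \sum_(Q <- qs) (Q (l a) (d a) (e a) && Q (l c) (d c) (e c)) <=
    ((l a, d a, f (l a) (d a) (e a)) == (l c, d c, f (l c) (d c) (e c))) +
    ((l a, d a, f (l a) (d a) (e a)) == (l b, d b, f (l b) (d b) (e b))) +
    ((l b, d b, f (l b) (d b) (e b)) == (l c, d c, f (l c) (d c) (e c)))) ->
  \sum_(Q <- qs) #|island T W l d e Q| * (#|island T W l d e Q| - 5) <=
  5 * \sum_(c : bool * bool * bool) let n := #|island T W l d e (fun x y z => (x, y, f x y z) == c)| in n * n.-1.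
Proof.
move=> credit.
have := islands_le_same_cell T btw btwC btw_neq line_le1 no_clique6
  [seq island T W l d e Q | Q <- qs]
  (fun u v => [&& u \in W, v \in W & (l u, d u, f (l u) (d u) (e u)) == (l v, d v, f (l v) (d v) (e v))]).
rewrite (sum_same_class _ _ W (fun u => (l u, d u, f (l u) (d u) (e u)))) !big_map; apply.
move=> a b c abc; rewrite !big_map.
under eq_bigr do rewrite !inE.
have [aW|aW] := boolP (a \in W); last by rewrite big1.
have [cW|cW] := boolP (c \in W); last by rewrite big1 // => Q _; rewrite andbF.
have bW := W_conv _ _ _ abc aW cW.
by rewrite bW /=; apply: credit.
Qed.

(** This empties one of the eight cells. Two lines cross at most once, so it holds on one side of
    [l]; the caller replaces [l] by its negation when that is the other side. *)
Hypothesis R_de : forall p, p \in W -> ~~ l p -> d p -> e p.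

Local Notation N := (cell T W l d e).
Variables (w : nat).
Hypothesis w_le : w <= 146.
Hypothesis c111 : N true true true = 146 - w.
Hypothesis c110 : N true true false = w.
Hypothesis c101 : N true false true = 146.
Hypothesis c100 : N true false false = 146.
Hypothesis c01 : N false true true + N false true false = 146.
Hypothesis c001 : N false false true = 146.
Hypothesis c000 : N false false false = 146.

Let c010 : N false true false = 0.
Proof.
apply: eq_card0 => p; rewrite !inE; apply/negP => /andP[pW /and3P[/eqP lp /eqP dp /eqP ep]].
by have := R_de p pW; rewrite lp dp ep => /(_ isT isT).
Qed.

(** The first family is contradictory whenever w <= 138 and the second whenever w >= 80, so
    splitting at 109 leaves slack on both sides. *)
Lemma three_lines_absurd : False.
Proof.
have c011 : N false true true = 146 by have := c01; rewrite c010 addn0.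
have [w109|w110] := leqP w 109.
(* The islands are the twelve quadrants cut out by two of the three lines. If no line separates a
   from c, three quadrants contain both and all three pairs share a cell. If exactly one does, a
   single quadrant contains both, and b shares the cell of a or of c. Otherwise no quadrant contains
   both. *)
- lapply (cells_ineq
   ([seq (fun x y _ => (x == s) && (y == t)) | s <- [:: true; false], t <- [:: true; false]] ++
    [seq (fun x _ z => (x == s) && (z == t)) | s <- [:: true; false], t <- [:: true; false]] ++
    [seq (fun _ y z => (y == s) && (z == t)) | s <- [:: true; false], t <- [:: true; false]])
   (fun _ _ z => z)); last first.
    move=> a b c abc _ _ _; rewrite /= !big_cons big_nil.
    move: (l_conv _ _ _ abc) (d_conv _ _ _ abc) (e_conv _ _ _ abc).
    case: (l a); case: (l c) => L; rewrite ?(L erefl) {L};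
    case: (d a); case: (d c) => D; rewrite ?(D erefl) {D};
    case: (e a); case: (e c) => E; rewrite ?(E erefl) {E};
    by [|case: (l b)|case: (d b)|case: (e b)].
  rewrite /= !big_cons big_nil !card_island.
  rewrite sum_bool3 /= !card_island /= c111 c110 c101 c100 c011 c010 c001 c000.
  rewrite !mul1n !mul0n !addn0 !add0n (subnK w_le).
  have [u wu] : {u | 146 - w = u} by exists (146 - w).
  rewrite wu; have wuE : u + w = 146 by lia.
  (* The quadratic terms become atoms tied by linear relations, as [lia] requires; [sqE] is only an
     inequality because n - 5 is truncated. *)
  have sqE n : n * n <= n * (n - 5) + 5 * n by nia.
  have predE n : n * n.-1 + n = n * n by case: n => //= n; lia.
  have uuE : u * u + 292 * w = 146 * 146 + w * w by have -> : u = 146 - w by []; nia.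
  have ww : w * w <= 109 * w by rewrite leq_mul2r w109 orbT.
  move: (sqE (u + 146)) (sqE (w + 146)) (sqE w) (predE u) (predE w).
  move: (_ * (u + 146 - 5)) (_ * (w + 146 - 5)) (w * (w - 5)) (u * u.-1) (w * w.-1).
  lia.
(* Merging the two cells of [l && d] makes the right-hand side independent of [w]. *)
- lapply (cells_ineq
   [:: fun x y z => y; fun x y z => ~~ y && ~~ z; fun x y z => ~~ y && z;
       fun x y z => x && ~~ y; fun x y z => ~~ x && ~~ y; fun x y z => ~~ x && z;
       fun x y z => x && ~~ z; fun x y z => x && y; fun x y z => ~~ x && y;
       fun x y z => ~~ x && ~~ y && ~~ z; fun x y z => x && ~~ y && z]
   (fun _ y z => y || z)); last first.
    (* A merged cell meets at most three islands. Ends in two different merged cells have at most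
       one island in common; it meets only these two, so b shares one of them. *)
    move=> a b c abc /R_de Ra /R_de Rb /R_de Rc; rewrite /= !big_cons big_nil.
    move: (l_conv _ _ _ abc) (d_conv _ _ _ abc) (e_conv _ _ _ abc) Ra Rb Rc.
    case: (l a); case: (l c) => L; rewrite ?(L erefl) {L};
    case: (d a); case: (d c) => D; rewrite ?(D erefl) {D};
    case: (e a); case: (e c) => E; rewrite ?(E erefl) {E};
    case: (l b); case: (d b); case: (e b) => //= Ra Rb Rc;
    by [|move: (Ra isT isT)|move: (Rb isT isT)|move: (Rc isT isT)].
  rewrite /= !big_cons big_nil !card_island.
  rewrite sum_bool3 /= !card_island /= c111 c110 c101 c100 c011 c010 c001 c000.
  rewrite !mul1n !mul0n !addn0 !add0n (subnK w_le).
  (* Only the island [x && ~~ z], of size w + 146, still depends on w. *)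
  have : 256 * 251 <= (w + 146) * (w + 146 - 5) by apply: leq_mul; lia.
  move: (_ * (w + 146 - 5)); lia.
Qed.

End ThreeLines.

Local Open Scope ring_scope.

(** * Thresholds in an ordered field *)

Lemma avoid_between (R : realFieldType) (s : seq R) (a b : R) :
  a < b -> exists2 z, a < z < b & z \notin s.
Proof.
elim: s a b => [|c s IH] a b ab; first by exists ((a + b) / 2) => //; apply/andP; split; lra.
have [/andP[ac cb]|ncab] := boolP (a < c < b).
  have [z /andP[az zc] zs] := IH _ _ ac.
  exists z; first by rewrite az (lt_trans zc).
  by rewrite inE negb_or zs lt_eqF.
have [z azb zs] := IH _ _ ab; exists z => //.
by rewrite inE negb_or zs andbT; apply: contraNneq ncab => <-.
Qed.

Lemma seq_bounds (R : realFieldType) (s : seq R) :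
  exists2 M, 0 < M & forall c, c \in s -> - M < c < M.
Proof.
elim: s => [|c s [M M0 sM]]; first by exists 1.
exists (M + `|c|) => [|x]; first by rewrite ltr_wpDr.
rewrite inE => /predU1P[->|/sM].
  by have := ler_norm c; have := ler_norm (- c); rewrite normrN => ? ?; apply/andP; split; lra.
by have := normr_ge0 c => ? /andP[? ?]; apply/andP; split; lra.
Qed.

(** Makes the number of critical slopes in an interval decrease in the induction of
    [simultaneous_cut]. *)
Lemma count_lt (T : eqType) (P Q : pred T) (r : seq T) (c : T) :
  c \in r -> Q c -> ~~ P c -> subpred P Q -> (count P r < count Q r)%N.
Proof.
move=> cr Qc nPc PQ.
have -> : count Q r = (count P r + count (predD Q P) r)%N.
  elim: r {cr} => //= x r ->; case Px : (P x); rewrite ?(PQ _ Px) //=; lia.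
rewrite -[ltnLHS]addn0 ltn_add2l -has_count; apply/hasP; exists c => //=.
by rewrite nPc.
Qed.

(** Start below all values and raise the threshold past one value at a time; injectivity prevents
    two points from passing together. *)
Lemma cut_exists (R : realFieldType) (T : finType) (U : {set T}) (v : T -> R) (m : nat) :
  {in U &, injective v} -> (m <= #|U|)%N ->
  exists b : R, #|[set p in U | v p < b]| = m.
Proof.
move=> v_inj; elim: m => [|m IH] mU.
  have [M _ sM] := seq_bounds _ [seq v p | p <- enum U].
  exists (- M); apply: eq_card0 => p; rewrite !inE; apply/negP => /andP[pU].
  have /sM/andP[+ _] : v p \in [seq v p | p <- enum U] by rewrite map_f ?mem_enum.
  by move/lt_trans => h /h; rewrite ltxx.
have [b bm] := IH (ltnW mU).
pose V := U :\: [set p in U | v p < b].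
have VE p : (p \in V) = (p \in U) && (b <= v p).
  by rewrite !inE; case: (p \in U); rewrite ?andbT ?andbF //= -leNgt.
have /card_gt0P[q0 q0V] : (0 < #|V|)%N.
  rewrite cardsDS ?bm ?subn_gt0 //; apply/subsetP => p; by rewrite inE => /andP[].
have [q qV qmin] : exists2 q, q \in V & forall p, p \in V -> v q <= v p.
  by case: (arg_minP v q0V) => q qV qmin; exists q.
(* The new threshold is the next value after that of [q], or anything larger when [q] is last; the
   cut being strict, only [q] is added. *)
have [c qc cmin] : exists2 c, v q < c & forall p, p \in V -> p != q -> c <= v p.
  case: (pickP [pred p in V | p != q]) => [r0 r0V|noV]; last first.
    by exists (v q + 1) => [|p pV pq]; [lra | have := noV p; rewrite /= pV pq].
  case: (arg_minP v (r0V : [pred p in V | p != q] r0)) => r /andP[rV rq] rmin.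
  exists (v r) => [|p pV pq]; last by apply: rmin; rewrite /= pV pq.
  rewrite lt_neqAle qmin // andbT; apply: contra_neq rq => /esym.
  by apply: v_inj; [move: rV | move: qV]; rewrite VE => /andP[].
exists c.
suff -> : [set p in U | v p < c] = q |: [set p in U | v p < b].
  by rewrite cardsU1 bm inE; move: qV; rewrite VE => /andP[-> ]; rewrite leNgt => /negbTE ->.
apply/setP => p; rewrite !inE; have := VE q; rewrite qV => /esym/andP[qU bq].
have [->|pq] := eqVneq p q; first by rewrite qU qc.
have [pU|//] := boolP (p \in U); rewrite /=.
have [pb|bp] := ltP (v p) b; first by rewrite (lt_trans pb) // (le_lt_trans bq).
by apply/negbTE; rewrite -leNgt; apply: cmin; rewrite // VE pU.
Qed.

(** * A discrete ham-sandwich cut of two separated sets *)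

Section SimultaneousCut.
Variables (R : realFieldType) (T : finType) (X Y : T -> R).
Hypothesis X_inj : injective X.
Variables (A B : {set T}).
Hypothesis X_AB : forall a b, a \in A -> b \in B -> X a < X b.
Hypothesis no4 : forall s a1 a2 b1 b2, a1 \in A -> a2 \in A -> b1 \in B -> b2 \in B ->
  a1 != a2 -> b1 != b2 ->
  Y a1 - s * X a1 = Y b1 - s * X b1 -> Y a1 - s * X a1 = Y b2 - s * X b2 ->
  Y a2 - s * X a2 = Y b1 - s * X b1 -> False.

(** The intercept of the line of slope [s] through [p]; thus [f s p < b] says that [p] lies below
    the line of slope [s] and intercept [b]. *)
Let f s p := Y p - s * X p.
Let slope p q := (Y q - Y p) / (X q - X p).
Let crit := undup [seq slope p q | p <- enum T, q <- enum T].

Let slope_crit p q : slope p q \in crit.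
Proof. by rewrite mem_undup; apply: allpairs_f; rewrite mem_enum. Qed.

Lemma residual_lt p q s : X p < X q -> (f s p < f s q) = (s < slope p q).
Proof.
move=> pq; rewrite /f /slope ltr_pdivlMr ?subr_gt0 //.
by apply/idP/idP => ?; lra.
Qed.

Lemma residual_gt p q s : X p < X q -> (f s q < f s p) = (slope p q < s).
Proof.
move=> pq; rewrite /f /slope ltr_pdivrMr ?subr_gt0 //.
by apply/idP/idP => ?; lra.
Qed.

Lemma residual_inj s : s \notin crit -> injective (f s).
Proof.
move=> sc p q fpq; apply/eqP; apply: contraNT sc => pq.
have Xpq : X p != X q by apply: contra_neq pq => /X_inj.
suff -> : s = slope p q by apply: slope_crit.
rewrite /slope; apply: (@mulIf _ (X q - X p)); first by rewrite subr_eq0 eq_sym.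
rewrite divfK ?subr_eq0 1?eq_sym //; move: fpq; rewrite /f; lra.
Qed.

Variables (i j : nat).
Hypothesis iA : (i <= #|A|)%N.
Hypothesis jB : (j <= #|B|)%N.
Let nA (s b : R) := #|[set p in A | f s p < b]|.
Let nB (s b : R) := #|[set p in B | f s p < b]|.

(** Fixing the total leaves only its distribution between [A] and [B] to vary with the slope. *)
Let good (s b : R) := (nA s b + nB s b = i + j)%N.

Lemma cut_AB s : s \notin crit -> exists b, good s b.
Proof.
move=> sc.
have dis : [disjoint A & B].
  rewrite -setI_eq0; apply/eqP/setP => p; rewrite !inE; apply/negP => /andP[pA pB].
  by have := X_AB _ _ pA pB; rewrite ltxx.
have cU : #|A :|: B| = (#|A| + #|B|)%N by apply/eqP; rewrite (leq_card_setU A B).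
have [||b bE] := cut_exists _ _ (A :|: B) (f s) (i + j).
- by move=> p q _ _; apply: residual_inj.
- by rewrite cU leq_add.
exists b; rewrite /good -bE /nA /nB.
have -> : [set p in A :|: B | f s p < b] = [set p in A | f s p < b] :|: [set p in B | f s p < b].
  by apply/setP => p; rewrite !inE andb_orl.
apply/esym/eqP; rewrite (leq_card_setU _ _).
rewrite -setI_eq0; apply/eqP/setP => p; rewrite !inE; apply/negP => /andP[/andP[pA _] /andP[pB _]].
by have := X_AB _ _ pA pB; rewrite ltxx.
Qed.

(* Passing one critical slope exchanges at most one point of [A] for one of [B], since
   exchanging two would put four points on a line. *)
Lemma single_crossing (s s' b b' : R) :
  (forall c c', c \in crit -> c' \in crit -> s < c < s' -> s < c' < s' -> c = c') ->
  good s b -> good s' b' -> (i <= nA s b)%N -> (nA s' b' <= i)%N ->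
  nA s b = i \/ nA s' b' = i.
Proof.
move=> one gb gb' Ai A'i.
have [->|Ani] := eqVneq (nA s b) i; first by left.
have [->|A'ni] := eqVneq (nA s' b') i; first by right.
have sub2 (C D : {set T}) : (#|D|.+1 < #|C|)%N -> (1 < #|C :\: D|)%N.
  by move=> DC; have := cardsID D C; have := subset_leq_card (subsetIr C D); lia.
(* The two counts in [A] miss [i] on opposite sides, so at least two points of [A] drop out of the
   cut; as the total is fixed, at least two points of [B] come in. *)
have /card_gt1P[a1 [a2 [a1D a2D a12]]] :
    (1 < #|[set p in A | (f s p < b)%R] :\: [set p in A | (f s' p < b')%R]|)%N.
  by apply: sub2; rewrite -/(nA s b) -/(nA s' b'); lia.
have /card_gt1P[b1 [b2 [b1D b2D b12]]] :
    (1 < #|[set p in B | (f s' p < b')%R] :\: [set p in B | (f s p < b)%R]|)%N.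
  by apply: sub2; move: gb gb'; rewrite /good -/(nB s b) -/(nB s' b'); lia.
have ADP a : a \in [set p in A | f s p < b] :\: [set p in A | f s' p < b'] ->
    [/\ a \in A, f s a < b & b' <= f s' a].
  by rewrite !inE => /andP[h /andP[hm hb]]; move: h; rewrite hm hb /= -leNgt => ->.
have BDP q : q \in [set p in B | f s' p < b'] :\: [set p in B | f s p < b] ->
    [/\ q \in B, f s' q < b' & b <= f s q].
  by rewrite !inE => /andP[h /andP[hm hb]]; move: h; rewrite hm hb /= -leNgt => ->.
have [a1A a1b a1b'] := ADP _ a1D; have [a2A a2b a2b'] := ADP _ a2D.
have [b1B b1b' b1b] := BDP _ b1D; have [b2B b2b' b2b] := BDP _ b2D.
(* A departing [a] and an entering [q] swap their intercept order, so their slope lies in the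
   interval. All such slopes are then equal, and the four points are collinear. *)
have mid a q : a \in A -> q \in B -> f s a < b -> b' <= f s' a ->
    f s' q < b' -> b <= f s q -> s < slope a q < s'.
  move=> aA qB h1 h2 h3 h4; rewrite -residual_lt ?X_AB // -residual_gt ?X_AB //.
  by rewrite (lt_le_trans h1 h4) (lt_le_trans h3 h2).
have e12 := one _ _ (slope_crit a1 b1) (slope_crit a1 b2)
  (mid _ _ a1A b1B a1b a1b' b1b' b1b) (mid _ _ a1A b2B a1b a1b' b2b' b2b).
have e21 := one _ _ (slope_crit a1 b1) (slope_crit a2 b1)
  (mid _ _ a1A b1B a1b a1b' b1b' b1b) (mid _ _ a2A b1B a2b a2b' b1b' b1b).
have slopeE a q : a \in A -> q \in B -> f (slope a q) a = f (slope a q) q.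
  move=> aA qB; rewrite /f; have := divfK (_ : X q - X a != 0) (Y q - Y a).
  by rewrite subr_eq0 gt_eqF ?X_AB // => /(_ isT); rewrite -/(slope a q); lra.
case: (no4 (slope a1 b1) a1 a2 b1 b2) => //; first exact: slopeE.
  by rewrite e12; apply: slopeE.
by rewrite e21; apply: slopeE.
Qed.

(* Discrete intermediate value argument on the slope [s]: the cut below which [i + j] points lie
   has at least [i] of them in [A] for [s] near -oo and at most [i] near +oo. *)
Lemma simultaneous_cut : exists s b, nA s b = i /\ nB s b = j.
Proof.
suff gen n : forall s s' b b' : R, (count (fun c => s < c < s')%R crit <= n)%N ->
    s < s' -> s \notin crit -> s' \notin crit -> good s b -> good s' b' ->
    (i <= nA s b)%N -> (nA s' b' <= i)%N -> exists s b, good s b /\ nA s b = i.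
  have [M M0 cM] := seq_bounds _ crit.
  have Mc : M \notin crit by apply/negP => /cM; rewrite ltxx andbF.
  have Mc' : - M \notin crit by apply/negP => /cM; rewrite ltxx.
  have [b gb] := cut_AB _ Mc'; have [b' gb'] := cut_AB _ Mc.
  case: (gen _ _ _ _ _ (leqnn _) _ Mc' Mc gb gb'); first lra.
  (* Below all critical slopes every point of [A] has a smaller intercept than every point of [B],
     so the cut exhausts [A] before it reaches [B]; above them the order is reversed. *)
  - have [B0|/card_gt0P[q]] := posnP (nB (- M) b); first by move: gb; rewrite /good; lia.
    rewrite inE => /andP[qB qb]; apply: leq_trans iA _; apply/subset_leq_card/subsetP => p pA.
    rewrite inE pA; apply: lt_trans qb; rewrite residual_lt ?X_AB //.
    by case/andP: (cM _ (slope_crit p q)).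
  - have [A0|/card_gt0P[p]] := posnP (nA M b'); first lia.
    rewrite inE => /andP[pA pb]; suff : (j <= nB M b')%N by move: gb'; rewrite /good; lia.
    apply: leq_trans jB _; apply/subset_leq_card/subsetP => q qB.
    rewrite inE qB; apply: lt_trans pb; rewrite residual_gt ?X_AB //.
    by case/andP: (cM _ (slope_crit p q)).
  by move=> s [b0 [g E]]; exists s, b0; split=> //; move: g; rewrite /good E; lia.
elim: n => [|n IH] s s' b b' cnt ss' sc s'c gb gb' Ai A'i.
  have one c c' : c \in crit -> c' \in crit -> s < c < s' -> s < c' < s' -> c = c'.
    move=> cc _ csc _; have : has (fun c => s < c < s') crit by apply/hasP; exists c.
    by rewrite has_count ltnNge cnt.
  by have [E|E] := single_crossing s s' b b' one gb gb' Ai A'i; [exists s, b|exists s', b'].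
have [one|] := pselect (forall c c', c \in crit -> c' \in crit ->
    s < c < s' -> s < c' < s' -> c = c').
  by have [E|E] := single_crossing s s' b b' one gb gb' Ai A'i; [exists s, b|exists s', b'].
move=> /existsNP[c1 /existsNP[c2 /not_implyP[c1c /not_implyP[c2c /not_implyP[c1i /not_implyP[c2i /eqP c12]]]]]].
wlog lt12 : c1 c2 c1c c2c c1i c2i c12 / c1 < c2.
  move=> W; have [|lt21] := ltP c1 c2; first exact: W.
  by apply: (W c2 c1) => //; [rewrite eq_sym | rewrite lt_neqAle eq_sym c12].
(* Bisect at a noncritical slope between two critical ones, and keep the half on which the count in
   [A] still passes [i]. *)
have [m /andP[c1m mc2] mc] := avoid_between _ crit _ _ lt12.
case/andP: c1i => sc1 c1s'; case/andP: c2i => sc2 c2s'.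
have sm : s < m by apply: lt_trans c1m.
have ms' : m < s' by apply: lt_trans c2s'.
have [bm gm] := cut_AB _ mc.
have [im|mi] := leqP i (nA m bm).
  apply: (IH m s' bm b') => //.
  rewrite -ltnS; apply: leq_trans cnt; apply: (@count_lt _ _ _ _ c1) => //.
  - by rewrite sc1 c1s'.
  - by rewrite (ltNge m) (ltW c1m).
  - by move=> x /andP[mx ->]; rewrite (lt_trans sm mx).
apply: (IH s m b bm) => //; last exact: ltnW.
rewrite -ltnS; apply: leq_trans cnt; apply: (@count_lt _ _ _ _ c2) => //.
- by rewrite sc2 c2s'.
- by rewrite (ltNge _ m) (ltW mc2) andbF.
- by move=> x /andP[-> mx]; rewrite (lt_trans mx ms').
Qed.

End SimultaneousCut.

(** * Construction of the three lines *)

Section PlanarPoints.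
Variables (R : realFieldType) (T : finType) (X Y : T -> R).
Variable btw : T -> T -> T -> bool.
Hypothesis btwC : forall a b c, btw a b c = btw c b a.
Hypothesis btw_neq : forall a b c, btw a b c -> [/\ a != b, b != c & a != c].
Hypothesis line_le1 : forall u v, u != v ->
  (\sum_w (btw u w v + btw u v w + btw w u v) <= 1)%N.
Hypothesis no_clique6 : forall Q : {set T}, #|Q| = 6%N ->
  exists u v, [/\ u \in Q, v \in Q, u != v & [exists w, btw u w v]].
Hypothesis X_inj : injective X.
Hypothesis btw_seg : forall a b c, btw a b c -> exists2 t, 0 < t < 1 &
  X b = (1 - t) * X a + t * X c /\ Y b = (1 - t) * Y a + t * Y c.
Hypothesis no_four_on_line : forall s k p, uniq p -> size p = 4%N ->
  (forall u, u \in p -> Y u - s * X u = k) -> False.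

(** An open half-plane and its complement are both convex. The form g X + h Y covers the vertical
    lines as well as those of given slope. *)
Lemma halfplane_conv (g h k : R) a b c : btw a b c ->
  (g * X a + h * Y a < k) = (g * X c + h * Y c < k) ->
  (g * X b + h * Y b < k) = (g * X a + h * Y a < k).
Proof.
case/btw_seg => t /andP[t0 t1] [-> ->].
set u := g * X a + h * Y a; set v := g * X c + h * Y c.
have -> : g * ((1 - t) * X a + t * X c) + h * ((1 - t) * Y a + t * Y c) = (1 - t) * u + t * v.
  by rewrite /u /v; ring.
have s0 : 0 < 1 - t by lra.
case: (ltP u k) => uk; case: (ltP v k) => vk // _; first by nra.
by apply/negbTE; rewrite -leNgt; nra.
Qed.

Lemma planar_points_absurd : (876 <= #|T|)%N -> False.
Proof.
move=> T876.
have [|t2 W876] := cut_exists _ _ [set: T] X 876%N (in2W X_inj); first by rewrite cardsT.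
set W := [set p in setT | _] in W876.
have [|t1 L438] := cut_exists _ _ W X 438%N (in2W X_inj); first by rewrite W876.
pose l p := X p < t1.
pose L := [set p in W | l p]; pose R' := W :\: L.
have LE : #|L| = 438%N := L438.
have RE : #|R'| = 438%N.
  by rewrite cardsDS ?LE ?W876 //; apply/subsetP => p; rewrite inE => /andP[].
have inR p : (p \in R') = (p \in W) && ~~ l p.
  by rewrite !inE; case: (X p < t2); case: (l p).
have sepX p q : l p -> ~~ l q -> X p < X q by rewrite /l -leNgt; apply: lt_le_trans.
have no4 (s : R) a1 a2 b1 b2 : l a1 -> l a2 -> ~~ l b1 -> ~~ l b2 -> a1 != a2 -> b1 != b2 ->
    Y a1 - s * X a1 = Y b1 - s * X b1 -> Y a1 - s * X a1 = Y b2 - s * X b2 ->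
    Y a2 - s * X a2 = Y b1 - s * X b1 -> False.
  move=> a1l a2l b1l b2l a12 b12 e1 e2 e3.
  have neq a q : l a -> ~~ l q -> a != q by move=> al ql; apply: contraTneq al => ->.
  apply: (no_four_on_line s (Y a1 - s * X a1) [:: a1; a2; b1; b2]) => //.
    by rewrite /= !inE !negb_or a12 b12 !neq.
  move=> u; rewrite !inE => /or4P[] /eqP-> //; first by rewrite e3.
have bis (A B : {set T}) : A \subset L -> B \subset R' -> (146 <= #|A|)%N -> (146 <= #|B|)%N ->
    exists s b : R, #|[set p in A | Y p - s * X p < b]| = 146%N /\
                    #|[set p in B | Y p - s * X p < b]| = 146%N.
  move=> /subsetP AL /subsetP BR A146 B146.
  have Al p : p \in A -> l p by move/AL; rewrite inE => /andP[].
  have Bl p : p \in B -> ~~ l p by move/BR; rewrite inR => /andP[].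
  apply: simultaneous_cut => //; first by move=> a q /Al al /Bl; apply: sepX.
  by move=> s a1 a2 b1 b2 /Al ? /Al ? /Bl ? /Bl ?; apply: no4.
have [||//|//|s [b [Ld Rd]]] := bis L R'; rewrite ?LE ?RE //.
pose d p := Y p - s * X p < b.
pose UL := [set p in L | ~~ d p]; pose UR := [set p in R' | ~~ d p].
have compl (A : {set T}) (q : pred T) : #|A| = (#|[set p in A | q p]| + #|[set p in A | ~~ q p]|)%N.
  rewrite -(cardsID [set p | q p] A); congr (_ + _)%N; apply: eq_card => p; rewrite !inE //.
  by rewrite andbC.
have ULE : #|UL| = 292%N by have := compl L d; rewrite LE -/UL Ld; lia.
have URE : #|UR| = 292%N by have := compl R' d; rewrite RE -/UR Rd; lia.
have [||||s' [b' [Le Re]]] := bis UL UR; rewrite ?ULE ?URE //.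
- by apply/subsetP => p; rewrite inE => /andP[].
- by apply/subsetP => p; rewrite inE => /andP[].
pose e p := Y p - s' * X p < b'.
have sides x : [/\ cell T W l d e x true true + cell T W l d e x true false = 146%N,
    cell T W l d e x false true = 146%N & cell T W l d e x false false = 146%N]%N.
  have [S [SE Sd SUe SU]] : exists S : {set T},
      [/\ forall p, (p \in S) = (p \in W) && (l p == x), #|[set p in S | d p]| = 146%N,
          #|[set p in S | ~~ d p && e p]| = 146%N & #|[set p in S | ~~ d p]| = 292%N].
    case: x; [exists L|exists R']; split=> //.
    - by move=> p; rewrite inE; case: (l p).
    - by rewrite -Le; apply: eq_card => p; rewrite !inE /e andbA.
    - by move=> p; rewrite inR; case: (l p).
    - by rewrite -Re; apply: eq_card => p; rewrite !inE /e andbA.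
  have cE y z : cell T W l d e x y z = #|[set p in S | (d p == y) && (e p == z)]|.
    by apply: eq_card => p; rewrite [LHS]inE [RHS]inE SE !andbA.
  split.
  - rewrite !cE -Sd (compl [set p in S | d p] e); congr (_ + _)%N; apply: eq_card => p;
      rewrite [LHS]inE [RHS]inE [in RHS]inE -andbA; by case: (d p); case: (e p).
  - rewrite cE -SUe; apply: eq_card => p; rewrite [LHS]inE [RHS]inE.
    by case: (d p); case: (e p).
  - have := compl [set p in S | ~~ d p] e; rewrite SU.
    have -> : #|[set p in [set p in S | ~~ d p] | e p]| = 146%N.
      by rewrite -SUe; apply: eq_card => p; rewrite [LHS]inE [RHS]inE [in LHS]inE andbA.
    have -> : #|[set p in [set p in S | ~~ d p] | ~~ e p]| = cell T W l d e x false false.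
      rewrite cE; apply: eq_card => p; rewrite [LHS]inE [RHS]inE [in LHS]inE.
      by case: (d p); case: (e p); rewrite ?andbT ?andbF.
    lia.
have W_conv a c q : btw a c q -> a \in W -> q \in W -> c \in W.
  move=> acq; rewrite !inE /= => aW qW.
  have := @halfplane_conv 1 0 t2 _ _ _ acq.
  by rewrite !mul1r !mul0r !addr0 aW qW => ->.
have l_conv a c q : btw a c q -> l a = l q -> l c = l a.
  by move/(@halfplane_conv 1 0 t1); rewrite !mul1r !mul0r !addr0.
have line_conv (g k : R) a c q : btw a c q -> (Y a - g * X a < k) = (Y q - g * X q < k) ->
    (Y c - g * X c < k) = (Y a - g * X a < k).
  by move/(@halfplane_conv (- g) 1 k); rewrite !mul1r !mulNr ![- _ + _]addrC.
(* On each side of [l] some point lies above [d] and below [e]; it serves to compare the two lines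
   there. *)
have between y : exists r, [/\ r \in W, l r == y, b <= Y r - s * X r & Y r - s' * X r < b'].
  have [_ c01 _] := sides y; have : (0 < cell T W l d e y false true)%N by rewrite c01.
  case/card_gt0P => r; rewrite inE => /and4P[rW lr /eqP dr /eqP er].
  by exists r; split=> //; rewrite leNgt -/(d r) dr.
(* Line [e] minus line [d] is an affine function of X with slope s' - s, negative at [p] and
   positive at [r]. *)
have order p r : d p -> ~~ e p -> b <= Y r - s * X r -> Y r - s' * X r < b' ->
    0 < (s' - s) * (X r - X p).
  by rewrite /d /e -leNgt => dp ep dr er; lra.
have finish (m : T -> bool) : (forall p, p \in W -> ~~ m p -> d p -> e p) ->
    (forall a c q, btw a c q -> m a = m q -> m c = m a) ->
    (forall x, [/\ cell T W m d e x true true + cell T W m d e x true false = 146%N,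
    cell T W m d e x false true = 146%N & cell T W m d e x false false = 146%N]%N) -> False.
  move=> nm m_conv msides; have [t11 t01 t00] := msides true; have [f11 f01 f00] := msides false.
  apply: (three_lines_absurd T btw btwC btw_neq line_le1 no_clique6 W m d e W_conv m_conv
    (line_conv _ _) (line_conv _ _) nm (cell T W m d e true true false)) => //; lia.
case: (pickP [pred p in W | [&& ~~ l p, d p & ~~ e p]]) => [p /and4P[pW lp dp ep]|noR]; last first.
  apply: (finish l) => // p pW lp dp; apply: contraFT (noR p) => ep.
  by rewrite /= pW lp dp ep.
apply: (finish (fun q => ~~ l q)) => [q qW /negPn lq dq||x].
(* Points below [d] but not below [e] on both sides of [l], compared with [r1] and [r2] across [l],
   would force opposite signs of s' - s. *)
- apply: contraT => eq.
  have [r1 [_ /eqP lr1 dr1 er1]] := between true; have [r2 [_ /eqP lr2 dr2 er2]] := between false.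
  have X1 : X r1 < X p by apply: sepX; rewrite ?lr1.
  have X2 : X q < X r2 by apply: sepX; rewrite ?lr2.
  have := order p r1 dp ep dr1 er1; have := order q r2 dq eq dr2 er2; nra.
- by move=> a c q acq /negb_inj h; rewrite (l_conv _ _ _ acq h).
- have := sides (~~ x).
  suff cN y z : cell T W (fun q => ~~ l q) d e x y z = cell T W l d e (~~ x) y z by rewrite !cN.
  by apply: eq_card => q; rewrite [LHS]inE [RHS]inE; case: (l q); case: x.
Qed.

End PlanarPoints.

Local Open Scope fset_scope.
Local Open Scope ring_scope.

(** * From planar point sets to the betweenness relation *)

Section Plane.
Variables (R : realType) (P : {fset 'rV[R]_2}).
Hypothesis no_coll : ~ contains_collinear 4 P.
Hypothesis no_vis : ~ contains_visible 6 P.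

(** The inequality rules out the degenerate open segment from a point to itself, which consists of
    that point. *)
Let btw (a b c : P) : bool :=
  (a != c) && `[< in_open_segment (val a) (val c) (val b) >].

Let btwP a b c : reflect
  (a != c /\ exists2 t : R, 0 < t < 1 & val b = val a + t *: (val c - val a)) (btw a b c).
Proof.
apply: (iffP andP) => -[ac].
  move/asboolP => [t t01 E]; split=> //; exists t => //.
  by rewrite E scalerBr scalerBl scale1r addrAC addrA.
move=> [t t01 E]; split=> //; apply/asboolP; exists t => //.
by rewrite E scalerBr scalerBl scale1r addrAC addrA.
Qed.

Let btwC a b c : btw a b c = btw c b a.
Proof.
suff H u v w : btw u v w -> btw w v u by apply/idP/idP; apply: H.
case/btwP => uw [t /andP[t0 t1] E]; apply/btwP; rewrite eq_sym; split=> //.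
exists (1 - t); first by apply/andP; split; lra.
by rewrite E; apply/rowP => i; rewrite !mxE; ring.
Qed.

Let btw_neq a b c : btw a b c -> [/\ a != b, b != c & a != c].
Proof.
suff H u v w : btw u v w -> u != v.
  by move=> abc; split; [apply: H abc|rewrite eq_sym; apply: (H c b a); rewrite btwC|case/andP: abc].
case/btwP => uw [t /andP[t0 t1] E]; apply: contraNneq uw => uv; apply/eqP/val_inj.
move: E; rewrite -uv -{1}[val u]addr0 => /addrI/esym/eqP.
by rewrite scaler_eq0 gt_eqF //= subr_eq0 => /eqP.
Qed.

Let no_four (s : seq P) (p v : 'rV[R]_2) : uniq s -> size s = 4%N -> v != 0 ->
  (forall w, w \in s -> exists a, val w = p + a *: v) -> False.
Proof.
move=> su s4 v0 sp; apply: no_coll; exists [fset x in map val s]; split.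
- by apply/fsubsetP => x; rewrite inE /= => /mapP[w _ ->]; apply: valP.
- by rewrite card_fseq undup_id ?size_map // map_inj_uniq //; apply: val_inj.
- by exists p, v; split=> // x; rewrite inE /= => /mapP[w /sp ? ->].
Qed.

Let third u v w := (btw u w v + btw u v w + btw w u v)%N.

Let third_param u v w : u != v -> (0 < third u v w)%N -> exists a, val w = val u + a *: (val v - val u).
Proof.
move=> uv; rewrite /third; have [/btwP[_ [t _ ->]] _|_] := boolP (btw u w v); first by exists t.
have [/btwP[_ [t /andP[t0 _] ->]] _|_] := boolP (btw u v w).
  exists t^-1; rewrite addrAC subrr add0r scalerA mulVf ?gt_eqF // scale1r.
  by rewrite addrC subrK.
have [/btwP[_ [t /andP[_ t1] E]] _|//] := boolP (btw w u v).
exists (- (t / (1 - t))).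
have t1' : 1 - t != 0 by rewrite gt_eqF // subr_gt0.
apply/rowP => i; move/rowP/(_ i): E; rewrite !mxE => ->; field.
by rewrite t1'.
Qed.

Let third_le1 u v w : u != v -> (third u v w <= 1)%N.
Proof.
have H x y z : btw x y z -> btw x z y = false.
  case/btwP => xz [t /andP[t0 t1] E]; apply/negP => /btwP[xy [r /andP[r0 r1] E']].
  move: E'; rewrite E addrAC subrr add0r scalerA -{1}[val z]addr0.
  have xz' : val z - val x != 0 by rewrite subr_eq0; apply: contra_neq xz => /val_inj.
  move/(congr1 (fun q => q - val x)); rewrite addr0 [X in _ = X]addrAC subrr add0r.
  rewrite -{1}[val z - val x]scale1r => /eqP; rewrite -subr_eq0 -scalerBl scaler_eq0.
  by rewrite (negbTE xz') orbF => /eqP; nra.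
move=> uv; rewrite /third.
have [uwv|] := boolP (btw u w v).
  have -> : btw u v w = false by apply: H.
  suff -> : btw w u v = false by [].
  by rewrite btwC; apply: H; rewrite btwC.
have [uvw _|_ _] := boolP (btw u v w); last by case: (btw w u v).
suff -> : btw w u v = false by [].
by apply/negP => wuv; have := H w v u; rewrite btwC uvw wuv => /(_ isT).
Qed.

(** Two different third points on the line through [u] and [v] would give four collinear points, and
    by [third_le1] one third point occurs in only one order. *)
Let line_le1 u v : u != v -> (\sum_w (btw u w v + btw u v w + btw w u v) <= 1)%N.
Proof.
move=> uv; rewrite -/(third u v _).
case: (pickP [pred w | (0 < third u v w)%N]) => [w0 /= w00|no]; last first.
  by rewrite big1 // => w _; apply/eqP; rewrite -leqn0 leqNgt; apply/negP; rewrite [(_ < _)%N]no.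
rewrite (bigD1 w0) //= big1 ?addn0; first exact: third_le1.
move=> w ww0; apply/eqP; rewrite -leqn0 leqNgt; apply/negP => w0'.
have third_neq x : (0 < third u v x)%N -> x != u /\ x != v.
  rewrite /third; case: (boolP (btw u x v)) => [/btw_neq[]|_]; first by rewrite eq_sym.
  case: (boolP (btw u v x)) => [/btw_neq[]|_]; first by rewrite [v == _]eq_sym [u == x]eq_sym.
  by case: (boolP (btw x u v)) => [/btw_neq[]|].
have [wu wv] := third_neq _ w0'; have [w0u w0v] := third_neq _ w00.
apply: (@no_four [:: u; v; w; w0] (val u) (val v - val u)) => //.
- rewrite /= !inE !negb_or uv ww0 /=.
  by rewrite [u == w]eq_sym [u == w0]eq_sym [v == w]eq_sym [v == w0]eq_sym wu wv w0u w0v.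
- by rewrite subr_eq0 eq_sym; apply: contra_neq uv => /val_inj.
- move=> x; rewrite !inE => /or4P[] /eqP ->.
  + by exists 0; rewrite scale0r addr0.
  + by exists 1; rewrite scale1r addrC subrK.
  + exact: third_param.
  + exact: third_param.
Qed.

Let no_clique6 (Q : {set P}) : #|Q| = 6%N ->
  exists u v, [/\ u \in Q, v \in Q, u != v & [exists w, btw u w v]].
Proof.
move=> Q6; apply: contrapT => noQ; apply: no_vis.
exists [fset x in map val (enum Q)]; split.
- by apply/fsubsetP => x; rewrite inE /= => /mapP[w _ ->]; apply: valP.
- rewrite card_fseq undup_id ?size_map -?cardE // map_inj_uniq ?enum_uniq //; exact: val_inj.
- move=> x y; rewrite !inE /= => /mapP[u + ->] /mapP[v + ->]; rewrite !mem_enum => uQ vQ uv.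
  split=> // z zP zuv; apply: noQ; exists u, v; split=> //.
  by apply/existsP; exists [` zP]; rewrite /btw uv; apply/asboolP.
Qed.

Lemma card_lt_876 : (#|` P| < 876)%N.
Proof.
rewrite ltnNge; apply/negP; rewrite cardfE => P876.
pose x (p : P) := val p ord0 ord0; pose y (p : P) := val p ord0 (lift ord0 ord0).
have xyE (p q : P) : x p = x q -> y p = y q -> p = q.
  move=> xe ye; apply/val_inj/rowP => i.
  by case: (unliftP ord0 i) => [j ->|->] //; rewrite (ord1 j).
have [s sM s_bad] := seq_bounds _ [seq (x q - x p) / (y p - y q) | p <- enum {: P}, q <- enum {: P}].
(* a shear making the first coordinate injective *)
pose X p := x p + s * y p.
have X_inj : injective X.
  move=> p q Xpq; have [yE|yN] := eqVneq (y p) (y q).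
    by apply: xyE => //; move: Xpq; rewrite /X yE => /addIr.
  have /s_bad : (x q - x p) / (y p - y q) \in [seq (x q - x p) / (y p - y q) | p <- enum {: P}, q <- enum {: P}].
    by apply: allpairs_f; rewrite mem_enum.
  suff -> : (x q - x p) / (y p - y q) = s by rewrite ltxx andbF.
  apply: (@mulIf _ (y p - y q)); first by rewrite subr_eq0.
  by rewrite divfK ?subr_eq0 //; move: Xpq; rewrite /X; lra.
apply: (@planar_points_absurd R P X y btw) => //.
- move=> a b c /btwP[_ [t t01 E]]; exists t => //.
  by rewrite /X /x /y E !mxE; split; ring.
- move=> r k [|a1 p] // pu p4 pk.
  (* The direction (1, r) in sheared coordinates, pulled back by the inverse shear x = X - s y. *)
  pose v : 'rV[R]_2 := \row_i (if i == ord0 then 1 - s * r else r).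
  apply: (@no_four (a1 :: p) (val a1) v) => //.
    apply/eqP => /rowP v0; have := v0 ord0; have := v0 (lift ord0 ord0).
    by rewrite !mxE /= => ->; rewrite mulr0 subr0; apply/eqP/oner_neq0.
  move=> w wp; exists (X w - X a1); have := pk _ wp; have := pk a1; rewrite mem_head => /(_ isT) <-.
  move=> E; apply/rowP => i; rewrite !mxE; case: (unliftP ord0 i) => [j ->|->] /=.
    by rewrite (ord1 j) -/(y w) -/(y a1); lra.
  by rewrite -/(x w) -/(x a1) /X; move: E; rewrite /X; nra.
Qed.

End Plane.

(** * Existence of N(4,6) and the bound *)

Lemma forces_is_N (R : realType) (s t n : nat) :
  forces R s t n -> exists m : nat, is_N R s t m /\ (m <= n)%N.
Proof.
move=> Fn.
have ex : exists m, `[< forces R s t m >] by exists n; apply/asboolP.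
case: (ex_minnP ex) => m /asboolP Fm minm.
exists m; split; last by apply: minm; apply/asboolP.
by split=> // k Fk; apply: minm; apply/asboolP.
Qed.

Theorem mainTheorem1 (R : realType) :
  (forall P : {fset 'rV[R]_2}, (880 <= #|` P|)%N ->
     contains_collinear 4 P \/ contains_visible 6 P) /\
  (exists n : nat, is_N R 4 6 n /\ (n <= 880)%N).
Proof.
suff F : forces R 4 6 880 by split; [exact: F | exact: forces_is_N].
move=> P P880.
have [|no_coll] := pselect (contains_collinear 4 P); first by left.
have [|no_vis] := pselect (contains_visible 6 P); first by right.
by have := leq_trans P880 (ltnW (card_lt_876 R P no_coll no_vis)).
Qed.
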